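(* For $(a,b,m,n)\in\mathcal{Q}$ and $F,G\in\mathbb{C}[x,y]$ consider the conditions (1) $N^0(F)=T_{m,n}$ and $N^0(F-x^my^n)\subsetneq N^0(F)$; (2) $F^{(0,1)}_{n-i}$ is divisible by $(x+1)^{m-i}$ for $0\le i\le m$; (3) $F^{(1,1)}_{m+n-i}$ is divisible by $(x+y)^{n-i}$ for $0\le i\le n$; (4) $N^0(G)=T_{bm/a,bn/a}$ and $N^0(G-x^{bm/a}y^{bn/a})\subsetneq N^0(G)$; (5) $[F,G]\in\mathbb{C}$. Consider the following two assertions. **Assertion C.** For all $(a,b,m,n)\in\mathcal{Q}$ and all $F,G\in\mathbb{C}[x,y]$ satisfying (1)–(5), any of the following equivalent statements is true: (i) $\emptyset\in\mathbb{V}_F$; (ii) there is $\alpha\in\mathbb{T}$ such that $F-\alpha(E^\circ)=0$; (iii) $V^\circ=\emptyset$; (iv) $F^\circ=0$. **Assertion B.** For all $(a,b,m,n)\in\mathcal{Q}$ and all $F,G\in\mathbb{C}[x,y]$ satisfying (1)–(5), one has $[F,G]=0$. If Assertion C is true, then Assertion B is true.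
   Context: For $f,g\in\mathbb{C}[x,y]$, $[f,g]=\frac{\partial f}{\partial x}\frac{\partial g}{\partial y}-\frac{\partial g}{\partial x}\frac{\partial f}{\partial y}$. For $f=\sum f_{ij}x^iy^j\in\mathbb{C}[x,y]$, $\mathrm{supp}(f)=\{(i,j):f_{ij}\neq0\}\subset\mathbb{R}^2$; for $f\ne0$, $N^0(f)$ is the convex hull of $\mathrm{supp}(f)\cup\{(0,0)\}$, and $N^0(0)=\emptyset$. For integers $m,n$, $T_{m,n}=\{(x,y)\in\mathbb{R}^2: 0\le y\le n,\ 0\le x\le m+n-y\}$ (empty if $n<0$). $\mathcal{Q}=\{(a,b,m,n)\in\mathbb{Z}_{>0}^4: m<n,\ a\mid m,\ a\mid n,\ \gcd(a,b)=1,\ 2\le a<b\}$. $f^{(0,1)}_j$ is the sum of the terms of $f$ of $y$-degree $j$ and $f^{(1,1)}_j$ the sum of the terms of total degree $j$. $\mathbb{T}$ is the set of polynomials $\alpha(z)=z^k+e_{k-1}z^{k-1}+\dots+e_0\in\mathbb{C}[z]$ with $k\ge1$ and $e_{k-1}=0$. For $f\in\mathbb{C}[x,y]$, $\mathcal{E}(f)=\{E\in\mathbb{C}[x,y]: f=\alpha(E)\text{ for some }\alpha\in\mathbb{T}\}$; $f$ is called principal if $\mathcal{E}(f)=\{f\}$. Let $(a,b,m,n)\in\mathcal{Q}$ and let $F$ satisfy (1)–(3). Put $\mathcal{N}'=\frac1aT_{m,n}$ and $\mathcal{N}''=\mathcal{N}'+\frac{a-1}{a}(m,n)$. There is a unique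 polynomial $Q\in\mathbb{C}[x,y]$ with $N^0(Q-x^{m/a}y^{n/a})\subsetneq N^0(Q)=\mathcal{N}'$ and $\mathrm{supp}(F-Q^a)\subseteq N^0(F)\setminus\mathcal{N}''$. There is a unique $\delta\in\mathbb{Z}_{>0}$ such that $N^0(E)=\frac{1}{\delta a}T_{m,n}$ for every principal polynomial $E\in\mathcal{E}(Q)$. $E^\circ$ (the $F$-generator) is the unique principal polynomial in $\mathcal{E}(Q)$ whose coefficient at $x^{m/(a\delta)}y^{n/(a\delta)}$ is $1$. Let $\mathbb{T}_F=\{\alpha\in\mathbb{T}:\mathrm{supp}(F-\alpha(E^\circ))\subseteq N^0(F)\setminus\mathcal{N}''\}$ (nonempty) and $\mathbb{V}_F=\{N^0(F-\alpha(E^\circ)):\alpha\in\mathbb{T}_F\}$, a finite set partially ordered by inclusion. For each such $F$ a minimal element $V^\circ\in\mathbb{V}_F$ and $\alpha^\circ\in\mathbb{T}_F$ with $V^\circ=N^0(F-\alpha^\circ(E^\circ))$ are fixed, and $F^\circ=F-\alpha^\circ(E^\circ)$ (the remainder). *)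

(* Defs.v *)
From mathcomp Require Export all_boot all_order all_algebra.
From mathcomp Require Export complex.
From mathcomp Require Export boolp classical_sets reals convex.
From mathcomp Require Export mpoly.

Set Implicit Arguments.
Unset Strict Implicit.
Unset Printing Implicit Defensive.

Import Order.TTheory GRing.Theory Num.Theory.

Local Open Scope ring_scope.
Local Open Scope classical_set_scope.

(* [C[x,y]] is [{mpoly R[i][2]}], with x and y the variables of index 0 and 1;
   [R[i]] is the field of complex numbers when [R : realType]. *)
Notation cpoly2 R := {mpoly R[i][2]}.
Notation varx := ('X_ord0) (only parsing).
Notation vary := ('X_ord_max) (only parsing).

Definition mon (i j : nat) : 'X_{1..2} := [multinom [:: i; j]].

Section Plane.
Variable R : realType.

Definition plane : lmodType R := (R^o * R^o)%type.

Definition dilate (t : R) (A : set plane) : set plane := [set t *: p | p in A].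

Definition translate (v : plane) (A : set plane) : set plane :=
  [set p + v | p in A].

Definition trapezoid (m n : int) : set plane :=
  [set p : plane | 0 <= p.2 <= n%:~R /\ 0 <= p.1 <= (m + n)%:~R - p.2].

Definition supp (f : cpoly2 R) : set plane :=
  [set ((mu ord0)%:R, (mu ord_max)%:R) | mu in [set` msupp f]].

Definition N0 (f : cpoly2 R) : set plane :=
  if f == 0 then set0
  else smallest (@convex_set R plane) (supp f `|` [set 0]).

End Plane.

Arguments trapezoid R m n : clear implicits.

Section Polynomials.
Variable R : realType.
Implicit Types (f g E F G Q : cpoly2 R) (alpha : {poly R[i]}).

Definition bracket f g : cpoly2 R :=
  f^`M(ord0) * g^`M(ord_max) - g^`M(ord0) * f^`M(ord_max).

(* The sum of the terms of [f] of (u,v)-weighted degree [j]. *)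
Definition wcomp (u v j : nat) f : cpoly2 R :=
  \sum_(mu <- msupp f | (u * mu ord0 + v * mu ord_max == j)%N)
    f@_mu *: 'X_[mu].

Definition divides f g : Prop := exists h, g = h * f.

(* Monic, of degree k >= 1, without term of degree k - 1; [size] is k + 1. *)
Definition TT : set {poly R[i]} :=
  [set alpha | [/\ alpha \is monic, (1 < size alpha)%N
                 & alpha`_(size alpha).-2 = 0]].

(* [horner_alg E alpha] is the composition alpha(E). *)
Definition EE f : set (cpoly2 R) :=
  [set E | exists2 alpha, TT alpha & f = horner_alg E alpha].

Definition principal f : Prop := EE f = [set f].

End Polynomials.

Definition inQ (a b m n : nat) : Prop :=
  [/\ (0 < a)%N, (0 < b)%N, (0 < m)%N & (0 < n)%N] /\
  [/\ (m < n)%N, (a %| m)%N, (a %| n)%N, coprime a b & (2 <= a < b)%N].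

Section Conditions.
Variable R : realType.
Implicit Types (F G : cpoly2 R).

Definition cond1 (m n : nat) F : Prop :=
  N0 F = trapezoid R m n /\ N0 (F - 'X_[mon m n]) `<` N0 F.

Definition cond2 (m n : nat) F : Prop :=
  forall i : nat, (i <= m)%N -> divides ((varx + 1) ^+ (m - i)) (wcomp 0 1 (n - i) F).

Definition cond3 (m n : nat) F : Prop :=
  forall i : nat, (i <= n)%N ->
    divides ((varx + vary) ^+ (n - i)) (wcomp 1 1 (m + n - i) F).

(* The quotients are exact, as [a] divides [m] and [n]. *)
Definition cond4 (a b m n : nat) G : Prop :=
  N0 G = trapezoid R (b * m %/ a)%N (b * n %/ a)%N /\
  N0 (G - 'X_[mon (b * m %/ a) (b * n %/ a)]) `<` N0 G.

Definition cond5 F G : Prop := exists c : R[i], bracket F G = c%:MP.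

End Conditions.

Section Generator.
Variable R : realType.
Variables (a m n : nat) (F : cpoly2 R).

Definition Npr : set (plane R) := dilate a%:R^-1 (trapezoid R m n).

Definition Nsec : set (plane R) :=
  translate ((a.-1%:R / a%:R) *: ((m%:R, n%:R) : plane R)) Npr.

(* [xget d A] is an element of [A], or [d] when [A] is empty; for [(a,b,m,n)]
   and [F] as in [cond1]-[cond3] the three sets below are singletons. *)
Definition rootQ : cpoly2 R :=
  xget 0 [set Q | [/\ N0 (Q - 'X_[mon (m %/ a) (n %/ a)]) `<` N0 Q,
                      N0 Q = Npr
                    & supp (F - Q ^+ a) `<=` N0 F `\` Nsec]].

Definition delta : nat :=
  xget 0%N [set d | (0 < d)%N /\
    forall E, EE rootQ E -> principal E ->
      N0 E = dilate (d * a)%:R^-1 (trapezoid R m n)].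

(* The generator of [F]; its Newton polygon has the vertex
   (m/(a delta), n/(a delta)), so the quotients are exact. *)
Definition Ecirc : cpoly2 R :=
  xget 0 [set E | [/\ EE rootQ E, principal E
                    & E@_(mon (m %/ (a * delta)) (n %/ (a * delta))) = 1]].

Definition TF : set {poly R[i]} :=
  [set alpha | TT alpha /\
               supp (F - horner_alg Ecirc alpha) `<=` N0 F `\` Nsec].

Definition VF : set (set (plane R)) :=
  [set N0 (F - horner_alg Ecirc alpha) | alpha in TF].

Definition minimal_choice (V : set (plane R)) (alpha : {poly R[i]}) : Prop :=
  [/\ VF V, forall W, VF W -> W `<=` V -> W = V, TF alpha
    & V = N0 (F - horner_alg Ecirc alpha)].

Definition remainder (alpha : {poly R[i]}) : cpoly2 R :=
  F - horner_alg Ecirc alpha.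

Lemma N0_eq0 (f : cpoly2 R) : N0 f = set0 <-> f = 0.
Proof.
rewrite /N0; case: eqP => // f0; split=> // h; exfalso.
have : (set0 : set (plane R)) 0 by rewrite -h => A [_]; apply; right.
by [].
Qed.

Lemma assertionC_tfae V alphao : minimal_choice V alphao ->
  [<-> VF set0;
       exists2 alpha, TT alpha & F - horner_alg Ecirc alpha = 0;
       V = set0;
       remainder alphao = 0].
Proof.
move=> [VV Vmin Ta VE]; tfae.
- by move=> [alpha [Talpha _] /N0_eq0 h]; exists alpha.
- move=> [alpha Talpha h]; apply/esym/Vmin => //.
  exists alpha; last by apply/N0_eq0.
  by split=> //; rewrite h /supp msupp0 => p [mu].
- by rewrite VE => /N0_eq0.
- by move=> /N0_eq0 h; exists alphao.
Qed.

End Generator.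

Section Assertions.
Variable R : realType.

(* The minimal element V and the polynomial alpha are arbitrary, but fixed for
   each (a,b,m,n) and F: the assertions are relative to selection functions. *)
Definition selection
    (Vsel : nat -> nat -> nat -> nat -> cpoly2 R -> set (plane R))
    (asel : nat -> nat -> nat -> nat -> cpoly2 R -> {poly R[i]}) : Prop :=
  forall (a b m n : nat) (F : cpoly2 R), inQ a b m n ->
    cond1 m n F -> cond2 m n F -> cond3 m n F ->
    minimal_choice a m n F (Vsel a b m n F) (asel a b m n F).

(* By [assertionC_tfae] any one of the four statements below is equivalent to
   each of the others; hence the disjunction. *)
Definition assertionC
    (Vsel : nat -> nat -> nat -> nat -> cpoly2 R -> set (plane R))
    (asel : nat -> nat -> nat -> nat -> cpoly2 R -> {poly R[i]}) : Prop :=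
  forall (a b m n : nat) (F G : cpoly2 R), inQ a b m n ->
    cond1 m n F -> cond2 m n F -> cond3 m n F -> cond4 a b m n G -> cond5 F G ->
    [\/ VF a m n F set0,
        exists2 alpha, TT alpha & F - horner_alg (Ecirc a m n F) alpha = 0,
        Vsel a b m n F = set0
      | remainder a m n F (asel a b m n F) = 0].

Definition assertionB : Prop :=
  forall (a b m n : nat) (F G : cpoly2 R), inQ a b m n ->
    cond1 m n F -> cond2 m n F -> cond3 m n F -> cond4 a b m n G -> cond5 F G ->
    bracket F G = 0.

End Assertions.

(* Main.v *)
Require Import Defs.
From mathcomp Require Import interval_inference.

(** If the generator [E] satisfies [F = alpha(E)], the chain rule gives
    [[F,G] = alpha'(E) [E,G]].  Suppose that this is a nonzero constant.  The
    degree is multiplicative under composition and additive under products, so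
    [alpha'(E)] has degree 0 although [E] has positive degree; hence [alpha']
    is constant and [alpha] has degree 1.  Being monic without subleading term,
    [alpha] is [z], that is, [F = E] ([horner_alg_normalized_unit]).

    This contradicts the size of the generator.  By construction a polynomial in
    [E] equals the approximate [a]-th root [Q] of [F], whose Newton polygon is
    that of [F] shrunk by the factor [1/a]; so [deg E <= deg Q <= (m+n)/a]
    ([msize_Ecirc]), while [F] has degree at least [m+n]
    ([msize_trapezoid]) and [a >= 2].

    That [Q] and [E] do lie in their defining sets follows from [F = alpha(E)]:
    if one of the sets were empty, the polynomial chosen from it would be 0,
    and [F] would be constant. *)

Set Implicit Arguments.
Unset Strict Implicit.
Unset Printing Implicit Defensive.

Import Order.TTheory GRing.Theory Num.Theory.

Local Open Scope ring_scope.
Local Open Scope classical_set_scope.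

(** * Composition with a multivariate polynomial *)

Lemma msizeDC (n : nat) (K : nzRingType) (p : {mpoly K[n]}) (c : K) :
  (1 < msize p)%N -> msize (p + c%:MP) = msize p.
Proof.
move=> p1; apply/eqP; rewrite eqn_leq; apply/andP; split.
  rewrite (leq_trans (msizeD_le _ _)) // geq_max leqnn msizeC.
  by rewrite (leq_trans (leq_b1 _)) // ltnW.
have := msizeD_le (p + c%:MP) (- c%:MP).
rewrite addrK msizeN msizeC leq_max => /orP[//|/leq_trans/(_ (leq_b1 _))].
by rewrite leqNgt p1.
Qed.

Lemma horner_alg_mpolyC (n : nat) (K : comNzRingType) (e : K) (p : {poly K}) :
  horner_alg (e%:MP_[n]) p = (p.[e])%:MP.
Proof.
elim/poly_ind: p => [|p d IHp]; first by rewrite rmorph0 horner0 mpolyC0.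
rewrite rmorphD rmorphM /= IHp horner_algX horner_algC hornerMXaddC.
by rewrite mpolyCD mpolyCM -mul_mpolyC mulr1.
Qed.

(** Total degrees multiply under composition, because leading forms cannot
    cancel over an integral domain: in Horner's scheme each multiplication by
    [E] adds [deg E], and the constant added afterwards has lower degree. *)
Lemma msize_horner_alg (n : nat) (K : idomainType) (E : {mpoly K[n]})
    (p : {poly K}) : (1 < msize E)%N -> p != 0 ->
  msize (horner_alg E p) = ((size p).-1 * (msize E).-1).+1.
Proof.
move=> E1; have E0 : E != 0 by rewrite -msize_poly_eq0 -lt0n ltnW.
elim/poly_ind: p => [|p c IHp]; first by rewrite eqxx.
rewrite size_MXaddC rmorphD rmorphM /= horner_algX horner_algC -mul_mpolyC mulr1.
have [-> | p0] := eqVneq p 0.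
  rewrite rmorph0 !mul0r !add0r polyC_eq0 size_poly0 => c0.
  by rewrite (negPf c0) msizeC c0.
move=> _; rewrite /=.
have sp : (0 < size p)%N by rewrite size_poly_gt0.
have pE0 : horner_alg E p != 0 by rewrite -msize_poly_eq0 IHp.
have sM : msize (horner_alg E p * E) = (size p * (msize E).-1).+1.
  rewrite msizeM // IHp // -{2}(prednK sp) mulSn.
  by rewrite -{2}(prednK (ltnW E1)) addSn addnS addnC.
by rewrite msizeDC sM // ltnS muln_gt0 sp -subn1 subn_gt0.
Qed.

Lemma mderiv_horner_alg (n : nat) (K : comNzRingType) (i : 'I_n)
    (E : {mpoly K[n]}) (p : {poly K}) :
  mderiv i (horner_alg E p) = horner_alg E p^`() * mderiv i E.
Proof.
elim/poly_ind: p => [|p c IHp]; first by rewrite deriv0 !rmorph0 mderiv0 mul0r.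
rewrite derivD derivM derivC derivX addr0 mulr1 !rmorphD !rmorphM /=.
rewrite horner_algX horner_algC -mul_mpolyC mulr1.
by rewrite mderivD mderivC addr0 mderivM IHp mulrDl mulrAC.
Qed.

Lemma bracket_horner_alg (R : realType) (E G : cpoly2 R) (p : {poly R[i]}) :
  bracket (horner_alg E p) G = horner_alg E p^`() * bracket E G.
Proof. by rewrite /bracket !mderiv_horner_alg mulrBr mulrCA !mulrA. Qed.

(** Additivity of the degree leaves [p'(E)] no positive degree, so [p'] is
    constant; in characteristic 0 this bounds the degree of [p] itself. *)
Lemma size_deriv_horner_alg_unit (n : nat) (K : numFieldType)
    (E H : {mpoly K[n]}) (p : {poly K}) (c : K) : (1 < msize E)%N -> c != 0 ->
  horner_alg E p^`() * H = c%:MP -> (size p <= 2)%N.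
Proof.
move=> E1 c0 pH.
have pH0 : horner_alg E p^`() * H != 0 by rewrite pH mpolyC_eq0.
have /andP[pE0 H0] : (horner_alg E p^`() != 0) && (H != 0).
  by rewrite -negb_or -mulf_eq0.
have p'0 : p^`() != 0 by apply: contraNneq pE0 => ->; rewrite rmorph0.
have : msize (horner_alg E p^`() * H) = 1%N by rewrite pH msizeC c0.
have hpos : (0 < msize H)%N by rewrite lt0n msize_poly_eq0.
rewrite msizeM // msize_horner_alg // addSn /= -(prednK hpos) addnS => -[].
move=> /eqP; rewrite addn_eq0 muln_eq0 => /andP[+ _].
rewrite -!subn1 !subn_eq0 [(msize E <= 1)%N]leqNgt E1 orbF => s'.
apply/leq_sizeP => -[|j] // j1; apply/eqP.
have /leq_sizeP/(_ j j1)/eqP := s'.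
by rewrite coef_deriv mulrn_eq0.
Qed.

(** The normalization of [TT] leaves ['X] as its only member of degree 1; this
    excludes the translates [E + e], whose derivative is 1 as well. *)
Lemma horner_alg_normalized_unit (R : realType) (E H : cpoly2 R)
    (p : {poly R[i]}) (c : R[i]) : TT p -> (1 < msize E)%N -> c != 0 ->
  horner_alg E p^`() * H = c%:MP -> horner_alg E p = E.
Proof.
move=> [pmonic psz p0] E1 c0 pH.
have s2 : size p = 2%N.
  apply/eqP; rewrite eqn_leq psz andbT.
  exact: size_deriv_horner_alg_unit E1 c0 pH.
rewrite s2 /= in p0; suff -> : p = 'X by rewrite /= horner_algX.
apply/polyP => -[|[|i]]; rewrite coefX /=.
- by rewrite p0.
- by move/monicP: pmonic; rewrite lead_coefE s2.
- by rewrite nth_default ?s2.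
Qed.

(** * Degrees and Newton polygons *)

Lemma mdeg2 (mu : 'X_{1..2}) : mdeg mu = (mu ord0 + mu ord_max)%N.
Proof.
by rewrite mdegE big_ord_recr big_ord1; congr (mu _ + mu _)%N; apply: val_inj.
Qed.

Lemma supp_N0 (R : realType) (f : cpoly2 R) (mu : 'X_{1..2}) :
  mu \in msupp f -> N0 f ((mu ord0)%:R, (mu ord_max)%:R).
Proof.
move=> muf; rewrite /N0; case: eqP => [f0|_ A [_]].
  by rewrite f0 msupp0 in muf.
by apply; left; exists mu.
Qed.

(** The half-plane [x + y <= t] is convex and contains the origin, so it
    contains the Newton polygon as soon as it contains the support. *)
Lemma N0_le_degree (R : realType) (f : cpoly2 R) (t : R) : 0 <= t ->
  (forall mu, mu \in msupp f -> (mdeg mu)%:R <= t) ->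
  forall p, N0 f p -> p.1 + p.2 <= t.
Proof.
move=> t0 ft p; rewrite /N0; case: eqP => // _ /(_ [set q | q.1 + q.2 <= t]).
apply; split; last first.
  move=> _ [[mu muf <-]|->] /=; last by rewrite addr0.
  by rewrite -natrD -mdeg2 ft.
move=> x y l; rewrite !inE /= => xt yt.
have l0 : 0 <= l%:inum by [].
have l1 : 0 <= 1 - l%:inum by rewrite subr_ge0.
rewrite addrACA -[_ *: x.1 + _]scalerDr -[_ *: y.1 + _]scalerDr.
apply: le_trans (lerD (ler_wpM2l l0 xt) (ler_wpM2l l1 yt)) _.
by rewrite -mulrDl addrC subrK mul1r.
Qed.

(** The vertex [(m, n)] of the trapezoid forces the degree up to [m + n]. *)
Lemma msize_trapezoid (R : realType) (m n : nat) (F : cpoly2 R) :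
  N0 F = trapezoid R m n -> (m + n <= (msize F).-1)%N.
Proof.
move=> NF; have tF : trapezoid R m n (m%:R, n%:R).
  split; rewrite /= ?intrD -!pmulrn; first by rewrite ler0n lexx.
  by rewrite addrK lexx ler0n.
rewrite -(ler_nat R) natrD.
apply: (@N0_le_degree _ F _ _ _ (m%:R, n%:R)); rewrite ?ler0n ?NF //.
move=> mu /msize_mdeg_lt muF; rewrite ler_nat -ltnS.
by rewrite (ltn_predK muF).
Qed.

Lemma Npr_degree (R : realType) (a m n : nat) (p : plane R) : (0 < a)%N ->
  Npr a m n p -> a%:R * (p.1 + p.2) <= (m + n)%:R.
Proof.
move=> a0 [[u v] [_ /= /andP[_]]]; rewrite -PoszD -pmulrn lerBrDr => uv <- /=.
by rewrite -scalerDr mulVKf // pnatr_eq0 -lt0n.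
Qed.

(** * The generator *)

Lemma rootQ_N0 (R : realType) (a m n : nat) (F : cpoly2 R) :
  rootQ a m n F <> 0 -> N0 (rootQ a m n F) = Npr a m n.
Proof. by rewrite /rootQ; case: xgetP => // Q -> []. Qed.

Lemma Ecirc_root (R : realType) (a m n : nat) (F : cpoly2 R) :
  Ecirc a m n F <> 0 -> EE (rootQ a m n F) (Ecirc a m n F).
Proof. by rewrite /Ecirc; case: xgetP => // E -> []. Qed.

(** The degree of the generator divides that of [rootQ a m n F], and the Newton
    polygon of the latter bounds its degree by [(m + n) / a].  That the
    generator is nonconstant makes both choices genuine, since the default
    value of either would be 0. *)
Lemma msize_Ecirc (R : realType) (a m n : nat) (F : cpoly2 R) : (0 < a)%N ->
  (1 < msize (Ecirc a m n F))%N ->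
  ((msize (Ecirc a m n F)).-1 * a <= m + n)%N.
Proof.
move=> a0; set E := Ecirc a m n F => E1.
have [beta [bmonic bsz _] Qb] : EE (rootQ a m n F) E.
  by apply: Ecirc_root => E0; rewrite /E E0 msize0 in E1.
have szQ : (msize E <= msize (rootQ a m n F))%N.
  rewrite Qb msize_horner_alg ?monic_neq0 // -{1}(ltn_predK E1) ltnS leq_pmull //.
  by rewrite -subn1 subn_gt0.
have NQ : N0 (rootQ a m n F) = Npr a m n.
  by apply: rootQ_N0 => Q0; move: (leq_trans E1 szQ); rewrite Q0 msize0.
suff Qd : (msize (rootQ a m n F) <= ((m + n) %/ a).+1)%N.
  by rewrite -leq_divRL // -ltnS (ltn_predK E1) (leq_trans szQ).
rewrite msizeE; apply/bigmax_leqP_seq => mu muQ _; rewrite ltnS leq_divRL //.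
have := supp_N0 muQ; rewrite NQ => /Npr_degree /= -/(_ a0).
by rewrite -natrD -mdeg2 -!natrM ler_nat mulnC.
Qed.

(** The statements on the remainder speak of the selected [alpha]; the
    selection hypothesis makes them equivalent to the existence of some
    [alpha]. *)
Lemma assertionC_generator (R : realType)
    (Vsel : nat -> nat -> nat -> nat -> cpoly2 R -> set (plane R))
    (asel : nat -> nat -> nat -> nat -> cpoly2 R -> {poly R[i]}) :
  selection Vsel asel -> assertionC Vsel asel ->
  forall (a b m n : nat) (F G : cpoly2 R), inQ a b m n ->
    cond1 m n F -> cond2 m n F -> cond3 m n F -> cond4 a b m n G -> cond5 F G ->
  exists2 alpha, TT alpha & F = horner_alg (Ecirc a m n F) alpha.
Proof.
move=> sel AC a b m n F G abmn F1 F2 F3 G4 FG5.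
have tfae := assertionC_tfae (sel _ _ _ _ _ abmn F1 F2 F3).
suff [alpha Talpha /eqP] : exists2 alpha, TT alpha &
    F - horner_alg (Ecirc a m n F) alpha = 0.
  by rewrite subr_eq0 => /eqP FE; exists alpha.
have [h|//|h|h] := AC _ _ _ _ _ _ abmn F1 F2 F3 G4 FG5.
- exact/(tfae 0%N 1%N).
- exact/(tfae 2%N 1%N).
- exact/(tfae 3%N 1%N).
Qed.

Theorem lemma3p3 (R : realType)
    (Vsel : nat -> nat -> nat -> nat -> cpoly2 R -> set (plane R))
    (asel : nat -> nat -> nat -> nat -> cpoly2 R -> {poly R[i]}) :
  selection Vsel asel -> assertionC Vsel asel -> assertionB R.
Proof.
move=> sel AC a b m n F G abmn F1 F2 F3 G4 FG5.
have [alpha Talpha FE] := assertionC_generator sel AC abmn F1 F2 F3 G4 FG5.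
have [[a0 _ m0 _] [_ _ _ _ /andP[a2 _]]] := abmn.
have szF := msize_trapezoid F1.1.
have mn0 : (0 < m + n)%N by rewrite addn_gt0 m0.
have [c FGc] := FG5; rewrite FGc.
have [->|c0] := eqVneq c 0; first exact: mpolyC0.
exfalso.
set E := Ecirc a m n F in FE.
have F1' : (1 < msize F)%N by rewrite -subn_gt0 subn1 (leq_trans mn0).
have E1 : (1 < msize E)%N.
  rewrite ltnNge; apply: contraTN F1' => /msize1_polyC Ec.
  by rewrite FE Ec horner_alg_mpolyC msizeC -leqNgt leq_b1.
have FeqE : F = E.
  rewrite [LHS]FE; apply: (horner_alg_normalized_unit (H := bracket E G) _ _ c0) => //.
  by rewrite -bracket_horner_alg -FE.
have aE : ((msize F).-1 * a <= m + n)%N by rewrite FeqE msize_Ecirc.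
have : ((m + n) * a <= m + n)%N by rewrite (leq_trans _ aE) // leq_mul2r szF orbT.
by rewrite leqNgt ltn_Pmulr.
Qed.
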